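(* Let $\mathcal{I}$ be a collection of intervals in a poset $P$. If $\mathcal{R}$ and $\mathcal{R}'$ are two multi-sets of elements of $\widehat{\mathcal{I}}$ such that $\operatorname{Rk}_{\mathcal{I}}\mathbf{k}_{\mathcal{R}}=\operatorname{Rk}_{\mathcal{I}}\mathbf{k}_{\mathcal{R}'}$ and this common rank invariant is finite on all intervals of $\mathcal{I}$, then $\mathcal{R}=\mathcal{R}'$.
   Context: Fix a field $\mathbf{k}$. An interval in a poset $P$ is a non-empty subset $I$ that is convex ($s\le u\le t$ with $s,t\in I$ implies $u\in I$) and connected (any two elements of $I$ are joined by a finite sequence of elements of $I$ with consecutive ones comparable). $\mathbf{k}_I\colon P\to\mathrm{Vec}_{\mathbf{k}}$ is the representation equal to $\mathbf{k}$ on $I$ and $0$ elsewhere, with identity maps between comparable elements of $I$; for a multi-set $\mathcal{R}$ of intervals, $\mathbf{k}_{\mathcal{R}}=\bigoplus_{R\in\mathcal{R}}\mathbf{k}_R$ (with multiplicity). For $M\colon P\to\mathrm{Vec}_{\mathbf{k}}$ and an interval $I$, $\operatorname{Rk}_I M=\operatorname{rank}\left[\varprojlim M|_I\to\varinjlim M|_I\right]\in\mathbb{N}\cup\{\infty\}$ (the canonical map), and $\operatorname{Rk}_{\mathcal{I}}M$ is the function $I\mapsto\operatorname{Rk}_IM$ on $\mathcal{I}$. $\widehat{\mathcal{I}}=\left\{\bigcup X\mid X\subseteq\mathcal{I}\text{ directed}\right\}$, where (a non-empty) $X$ is directed if for all $I_1,I_2\in X$ there is $I_3\in X$ with $I_1\cup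 I_2\subseteq I_3$. Elements of $\widehat{\mathcal{I}}$ are again intervals, and $\mathcal{I}\subseteq\widehat{\mathcal{I}}$. *)

(* Defs.v *)
From HB Require Import structures.
From mathcomp Require Import all_boot all_order all_algebra.
From mathcomp Require Import ring_quotient.
From mathcomp Require Import boolp classical_sets functions cardinality.

Set Implicit Arguments.
Unset Strict Implicit.
Unset Printing Implicit Defensive.

Import Order.TTheory GRing.Theory.
Local Open Scope classical_set_scope.
Local Open Scope ring_scope.
Local Open Scope quotient_scope.
Local Open Scope card_scope.

Section DirectProduct.
Variables (k : fieldType) (T : Type) (V : T -> lmodType k).

Definition dprod : Type := forall t, V t.
Definition dprod_fun (f : dprod) : forall t, V t := f.
Coercion dprod_fun : dprod >-> Funclass.

HB.instance Definition _ := Choice.copy dprod (forall t, V t).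

Definition dprod_zero : dprod := fun=> 0.
Definition dprod_opp (f : dprod) : dprod := fun t => - f t.
Definition dprod_add (f g : dprod) : dprod := fun t => f t + g t.
Definition dprod_scale (a : k) (f : dprod) : dprod := fun t => a *: f t.

Fact dprod_addA : associative dprod_add.
Proof. by move=> f g h; apply: functional_extensionality_dep => t; exact: addrA. Qed.
Fact dprod_addC : commutative dprod_add.
Proof. by move=> f g; apply: functional_extensionality_dep => t; exact: addrC. Qed.
Fact dprod_add0 : left_id dprod_zero dprod_add.
Proof. by move=> f; apply: functional_extensionality_dep => t; exact: add0r. Qed.
Fact dprod_addN : left_inverse dprod_zero dprod_opp dprod_add.
Proof. by move=> f; apply: functional_extensionality_dep => t; exact: addNr. Qed.

HB.instance Definition _ :=
  GRing.isZmodule.Build dprod dprod_addA dprod_addC dprod_add0 dprod_addN.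

Fact dprod_scaleA a b (f : dprod) :
  dprod_scale a (dprod_scale b f) = dprod_scale (a * b) f.
Proof. by apply: functional_extensionality_dep => t; exact: scalerA. Qed.
Fact dprod_scale1 : left_id 1 dprod_scale.
Proof. by move=> f; apply: functional_extensionality_dep => t; exact: scale1r. Qed.
Fact dprod_scaleDr : right_distributive dprod_scale +%R.
Proof. by move=> a f g; apply: functional_extensionality_dep => t; exact: scalerDr. Qed.
Fact dprod_scaleDl (f : dprod) : {morph dprod_scale^~ f : a b / a + b}.
Proof. by move=> a b; apply: functional_extensionality_dep => t; exact: scalerDl. Qed.

HB.instance Definition _ := GRing.Zmodule_isLmodule.Build k dprod
  dprod_scaleA dprod_scale1 dprod_scaleDr dprod_scaleDl.

End DirectProduct.

Section DirectSum.
Variables (k : fieldType) (T : Type) (V : T -> lmodType k).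

Definition finsupp : {pred dprod V} :=
  fun f => `[< finite_set [set t | f t != 0] >].

Fact finsupp_submod : submod_closed finsupp.
Proof.
split=> [|a f g /asboolP ff /asboolP fg]; apply/asboolP.
  by apply: (sub_finite_set _ (@finite_set0 T)) => t /=; rewrite eqxx.
apply: sub_finite_set (_ : finite_set ([set t | f t != 0] `|` [set t | g t != 0])).
  move=> t /= h; case: (eqVneq (f t) 0) => [f0|]; last by left.
  right; apply: contraNN h => /eqP g0; apply/eqP.
  by change (a *: f t + g t = 0); rewrite f0 g0 scaler0 addr0.
by rewrite finite_setU.
Qed.
HB.instance Definition _ :=
  GRing.isSubmodClosed.Build k (dprod V) finsupp finsupp_submod.

Record dsum : Type := DSum { dsum_val :> dprod V ; _ : dsum_val \in finsupp }.
HB.instance Definition _ := [isSub for dsum_val].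
HB.instance Definition _ := [Choice of dsum by <:].
HB.instance Definition _ := [SubChoice_isSubLmodule of dsum by <:].

Lemma dsum_inj (f g : dsum) : (forall t, f t = g t) -> f = g.
Proof.
by move=> fg; apply: val_inj; apply: functional_extensionality_dep => t; exact: fg.
Qed.

End DirectSum.
Arguments finsupp {k T} V _.

Section DirectSumMap.
Variables (k : fieldType) (T : Type) (V W : T -> lmodType k).
Variable F : forall t, {linear V t -> W t}.

Fact dsum_map_subproof (f : dsum V) :
  ((fun t => F t (f t)) : dprod W) \in finsupp W.
Proof.
apply/asboolP; have /asboolP := valP f; apply: sub_finite_set => t /=.
by apply: contraNN => /eqP f0; apply/eqP; rewrite [X in F t X]f0 linear0.
Qed.

Definition dsum_map (f : dsum V) : dsum W := DSum (dsum_map_subproof f).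

Fact dsum_map_linear : linear dsum_map.
Proof. by move=> a f g; apply: dsum_inj => t; exact: linearP. Qed.
HB.instance Definition _ :=
  GRing.isLinear.Build k (dsum V) (dsum W) *:%R dsum_map dsum_map_linear.

End DirectSumMap.

Section Coprojection.
Variables (k : fieldType) (T : eqType) (V : T -> lmodType k) (t : T).

Fact dsum_in_subproof (v : V t) :
  (dfwith (fun=> 0) v : dprod V) \in finsupp V.
Proof.
apply/asboolP; apply: (sub_finite_set _ (finite_set1 t)) => s /=.
by case: dfwithP => // j _; rewrite eqxx.
Qed.

Definition dsum_in (v : V t) : dsum V := DSum (dsum_in_subproof v).

Fact dsum_in_linear : linear dsum_in.
Proof.
move=> a u v; apply: dsum_inj => s.
pose e (w : V t) : dprod V := @dfwith T V (fun=> 0) t w.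
change (e (a *: u + v) s = a *: e u s + e v s); rewrite /e /dprod_fun.
case: (eqVneq t s) => [ts|ts]; last by rewrite !dfwith_out // scaler0 addr0.
by case: s / ts; rewrite !dfwith_in.
Qed.
HB.instance Definition _ :=
  GRing.isLinear.Build k (V t) (dsum V) *:%R dsum_in dsum_in_linear.

End Coprojection.

Section Span.
Variables (k : fieldType) (V : lmodType k).

Definition span_set (S : set V) : set V :=
  smallest (fun A : set V => submod_closed [in A]) S.

Definition lspan (S : set V) : {pred V} := [in span_set S].

Fact lspan_submod (S : set V) : submod_closed (lspan S).
Proof.
split=> [|a u v]; rewrite !unfold_in /lspan /=.
  by apply/mem_set => A [[A0 _] _]; exact/set_mem.
move=> /set_mem uS /set_mem vS; apply/mem_set => A AS.
have [[_ AL] _] := AS.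
by apply/set_mem/AL; apply/mem_set; [exact: uS|exact: vS].
Qed.
HB.instance Definition _ (S : set V) :=
  GRing.isSubmodClosed.Build k V (lspan S) (lspan_submod S).

End Span.

Section QuotientSpace.
Variables (k : fieldType) (V : lmodType k) (S : set V).

(* The quotient of [V] by the subspace spanned by [S]. *)
Definition quotsp : Type := Quotient.quot (lspan S).
HB.instance Definition _ := GRing.Zmodule.copy quotsp (Quotient.quot (lspan S)).

Definition quot_pi (v : V) : quotsp := \pi_(Quotient.quot (lspan S)) v.

Lemma quot_piP (u v : V) : quot_pi u = quot_pi v <-> u - v \in lspan S.
Proof. by rewrite Quotient.idealrBE; split => /eqP. Qed.

Definition quot_scale (a : k) (x : quotsp) : quotsp :=
  quot_pi (a *: repr (x : Quotient.quot (lspan S))).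

Lemma quot_surj (x : quotsp) : exists v, x = quot_pi v.
Proof. by exists (repr (x : Quotient.quot (lspan S))); rewrite /quot_pi reprK. Qed.

Lemma quot_piD u v : quot_pi (u + v) = quot_pi u + quot_pi v.
Proof. by rewrite /quot_pi raddfD. Qed.

Lemma quot_piZ a v : quot_pi (a *: v) = quot_scale a (quot_pi v).
Proof.
apply/quot_piP; rewrite -scalerBr; apply: rpredZ.
by apply/quot_piP; rewrite {2}/quot_pi reprK.
Qed.

Fact quot_scaleA a b x : quot_scale a (quot_scale b x) = quot_scale (a * b) x.
Proof. by have [v ->] := quot_surj x; rewrite -!quot_piZ scalerA. Qed.
Fact quot_scale1 : left_id 1 quot_scale.
Proof. by move=> x; have [v ->] := quot_surj x; rewrite -quot_piZ scale1r. Qed.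
Fact quot_scaleDr : right_distributive quot_scale +%R.
Proof.
move=> a x y; have [u ->] := quot_surj x; have [v ->] := quot_surj y.
by rewrite -quot_piD -!quot_piZ -quot_piD scalerDr.
Qed.
Fact quot_scaleDl x : {morph quot_scale^~ x : a b / a + b}.
Proof.
by move=> a b; have [v ->] := quot_surj x; rewrite -!quot_piZ -quot_piD scalerDl.
Qed.
HB.instance Definition _ := GRing.Zmodule_isLmodule.Build k quotsp
  quot_scaleA quot_scale1 quot_scaleDr quot_scaleDl.

Fact quot_pi_linear : linear quot_pi.
Proof. by move=> a u v; rewrite quot_piD quot_piZ. Qed.
HB.instance Definition _ :=
  GRing.isLinear.Build k V quotsp *:%R quot_pi quot_pi_linear.

End QuotientSpace.

Section Rank.
Variables (k : fieldType) (V : lmodType k).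

Definition lin_indep n (b : 'I_n -> V) : Prop :=
  forall c : 'I_n -> k, \sum_i c i *: b i = 0 -> forall i, c i = 0.

(* For a linear subspace [U]: it has a basis with [n] elements. *)
Definition has_dim (U : set V) (n : nat) : Prop :=
  exists b : 'I_n -> V, [/\ forall i, U (b i), lin_indep b &
    forall u, U u -> exists c : 'I_n -> k, u = \sum_i c i *: b i].

Lemma has_dim_uniq (U : set V) m n : has_dim U m -> has_dim U n -> m = n.
Proof.
have le a b : has_dim U a -> has_dim U b -> (a <= b)%N.
  move=> [e [eU ei _]] [f [_ _ fs]].
  have [C eC] : exists C : 'I_a -> 'I_b -> k,
      forall i, e i = \sum_j C i j *: f j.
    have [C eC] := choice (fun i => fs (e i) (eU i)).
    by exists C.
  pose A := \matrix_(i, j) C i j.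
  suff /eqP <- : row_free A by exact: rank_leq_col.
  rewrite -kermx_eq0; apply/rowV0P => v /sub_kermxP vA; apply/rowP => i.
  rewrite mxE; move: i; apply: (ei (v 0)).
  under eq_bigr do rewrite eC scaler_sumr.
  rewrite exchange_big big1 // => j _.
  under eq_bigr do rewrite scalerA; rewrite -scaler_suml.
  have := congr1 (fun M : 'rV_b => M 0 j) vA; rewrite !mxE => vAj.
  by rewrite (eq_bigr (fun i => v 0 i * A i j)) ?vAj ?scale0r // => i _; rewrite !mxE.
by move=> hm hn; apply/eqP; rewrite eqn_leq !le.
Qed.

End Rank.

(* Rank of a linear map, in [nat] extended by [None] for infinity. *)
Definition lin_rank (k : fieldType) (V W : lmodType k) (f : {linear V -> W}) :
    option nat :=
  if pselect (exists n, has_dim (range f) n) is left h then Some (projT1 (cid h))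
  else None.

Record rep (k : fieldType) (d : Order.disp_t) (P : porderType d) : Type := Rep {
  rep_obj :> P -> lmodType k ;
  rep_map : forall x y : P, (x <= y)%O -> {linear rep_obj x -> rep_obj y} ;
  rep_map_id : forall (x : P) (h : (x <= x)%O) v, rep_map h v = v ;
  rep_map_comp : forall (x y z : P) (xy : (x <= y)%O) (yz : (y <= z)%O)
      (xz : (x <= z)%O) v,
    rep_map xz v = rep_map yz (rep_map xy v) }.

Section LimitColimit.
Variables (k : fieldType) (d : Order.disp_t) (P : porderType d) (M : rep k P).

Definition compatible : {pred dprod M} :=
  fun f => `[< forall (x y : P) (xy : (x <= y)%O), rep_map M xy (f x) = f y >].

Fact compatible_submod : submod_closed compatible.
Proof.
split=> [|a f g /asboolP ff /asboolP fg]; apply/asboolP => x y xy.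
  exact: linear0.
by change (rep_map M xy (a *: f x + g x) = a *: f y + g y); rewrite linearP ff fg.
Qed.
HB.instance Definition _ :=
  GRing.isSubmodClosed.Build k (dprod M) compatible compatible_submod.

Record limit : Type := Limit { limit_val :> dprod M ; _ : limit_val \in compatible }.
HB.instance Definition _ := [isSub for limit_val].
HB.instance Definition _ := [Choice of limit by <:].
HB.instance Definition _ := [SubChoice_isSubLmodule of limit by <:].

Definition limit_proj (x : P) (f : limit) : M x := f x.

Fact limit_proj_linear x : linear (limit_proj x).
Proof. by []. Qed.
HB.instance Definition _ x :=
  GRing.isLinear.Build k limit (M x) *:%R (limit_proj x) (limit_proj_linear x).

Definition colimit_rel : set (dsum M) :=
  [set u | exists (x y : P) (xy : (x <= y)%O) (v : M x),
    u = dsum_in v - dsum_in (rep_map M xy v)].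

Definition colimit : lmodType k := quotsp colimit_rel.

Definition colimit_in (x : P) : {linear M x -> colimit} :=
  @quot_pi k (dsum M) colimit_rel \o @dsum_in k P M x.

Definition limit_to_colimit (x : P) : {linear limit -> colimit} :=
  colimit_in x \o limit_proj x.

Lemma limit_to_colimit_le (x y : P) :
  (x <= y)%O -> limit_to_colimit x =1 limit_to_colimit y.
Proof.
move=> xy f; apply/quot_piP; rewrite unfold_in; apply/mem_set.
apply: sub_gen_smallest; exists x, y, xy, (f x).
by have /asboolP fc := valP f; rewrite (fc x y xy).
Qed.

End LimitColimit.

Section Restriction.
Variables (d : Order.disp_t) (P : porderType d) (A : set P).

Definition subposet : Type := set_type A.
HB.instance Definition _ := SubChoice.on subposet.
HB.instance Definition _ := [SubChoice_isSubPOrder of subposet by <: with d].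

Variables (k : fieldType) (M : rep k P).

Definition restr_map (x y : subposet) (xy : (x <= y)%O) :
    {linear M (val x) -> M (val y)} :=
  rep_map M (xy : (val x <= val y)%O).

Definition restr : rep k subposet :=
  @Rep k d subposet (fun x => M (val x)) restr_map
    (fun x h v => @rep_map_id k d P M (val x) h v)
    (fun x y z xy yz xz v =>
      @rep_map_comp k d P M (val x) (val y) (val z) xy yz xz v).

End Restriction.
Arguments restr {d P} A {k} M.

Section Intervals.
Variables (d : Order.disp_t) (P : porderType d).

Definition convex_set (A : set P) : Prop :=
  forall s u t : P, A s -> A t -> (s <= u)%O -> (u <= t)%O -> A u.

Definition connected_set (A : set P) : Prop :=
  forall s t : P, A s -> A t -> exists p : seq P,
    [/\ forall x, x \in p -> A x, path (>=<%O) s p & last s p = t].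

Record pinterval : Type := PInterval {
  pi_set :> set P ;
  pi_nonempty : pi_set !=set0 ;
  pi_convex : convex_set pi_set ;
  pi_connected : connected_set pi_set }.

Lemma pinterval_eq (I J : pinterval) : I = J :> set P -> I = J.
Proof.
case: I J => [A A0 Ac An] [B B0 Bc Bn] /= AB; subst B.
by congr PInterval; exact: Prop_irrelevance.
Qed.

Definition directed (X : set pinterval) : Prop :=
  X !=set0 /\ forall I1 I2, X I1 -> X I2 ->
    exists I3 : pinterval, X I3 /\ (I1 : set P) `|` I2 `<=` I3.

Definition hat (II : set pinterval) : set pinterval :=
  [set I | exists X : set pinterval,
    [/\ X `<=` II, directed X & (I : set P) = \bigcup_(J in X) J]].

Lemma subset_hat II : II `<=` hat II.
Proof.
move=> I III; exists [set I]; split; [by move=> J -> | | by rewrite bigcup_set1].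
split; first by exists I.
by move=> _ _ -> ->; exists I; split=> //; rewrite setUid.
Qed.

(* [hat] loses nothing by ranging over [pinterval]. *)
Lemma directed_bigcup_interval (X : set pinterval) : directed X ->
  exists I : pinterval, (I : set P) = \bigcup_(J in X) J.
Proof.
move=> [[I0 XI0] dX].
have pair s t : (\bigcup_(J in X) J) s -> (\bigcup_(J in X) J) t ->
    exists J : pinterval, [/\ X J, pi_set J s & pi_set J t].
  move=> [J1 X1 s1] [J2 X2 t2]; have [J [XJ sJ]] := dX _ _ X1 X2.
  by exists J; split=> //; apply: sJ; [left|right].
have ne : \bigcup_(J in X) J !=set0.
  by have [x Ix] := pi_nonempty I0; exists x, I0.
have cv : convex_set (\bigcup_(J in X) J).
  move=> s u t /pair h /h[J [XJ Js Jt]] su ut.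
  by exists J => //; exact: (pi_convex Js Jt su ut).
have cn : connected_set (\bigcup_(J in X) J).
  move=> s t /pair h /h[J [XJ Js Jt]].
  have [p [pJ ps pt]] := pi_connected Js Jt.
  by exists p; split=> // x xp; exists J => //; exact: pJ.
by exists (PInterval ne cv cn).
Qed.

End Intervals.

Section RankInvariant.
Variables (k : fieldType) (d : Order.disp_t) (P : porderType d).

Definition pi_point (I : pinterval P) : subposet I :=
  let h := cid (pi_nonempty I) in exist _ (projT1 h) (mem_set (projT2 h)).

(* The canonical map from the limit to the colimit of [M] restricted to [I];
   by connectedness of [I] it does not depend on the point it passes through. *)
Definition canonical_map (M : rep k P) (I : pinterval P) :
    {linear limit (restr I M) -> colimit (restr I M)} :=
  limit_to_colimit (restr I M) (pi_point I).

Lemma canonical_mapE (M : rep k P) (I : pinterval P) (x : subposet I) :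
  canonical_map M I =1 limit_to_colimit (restr I M) x.
Proof.
have [p [pI pp lp]] :=
  pi_connected (set_mem (valP (pi_point I))) (set_mem (valP x)).
move=> f; rewrite /canonical_map.
elim: p (pi_point I) pI pp lp => [|z p IHp] y pI /=.
  by move=> _ yx; congr (limit_to_colimit _ _ f); exact: val_inj.
move=> /andP[yz pp] lp.
have zI : z \in (I : set P) by apply/mem_set/pI; rewrite mem_head.
pose z' : subposet I := exist _ z zI.
transitivity (limit_to_colimit (restr I M) z' f); last first.
  by apply: IHp => // w wp; apply: pI; rewrite inE wp orbT.
case/orP: yz => h; [|symmetry].
  exact: (@limit_to_colimit_le k d _ (restr I M) y z' h f).
exact: (@limit_to_colimit_le k d _ (restr I M) z' y h f).
Qed.

Definition Rk (I : pinterval P) (M : rep k P) : option nat :=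
  lin_rank (canonical_map M I).

Definition rank_inv (II : set (pinterval P)) (M : rep k P) : II -> option nat :=
  fun I => Rk (val I) M.

End RankInvariant.
Arguments rank_inv {k d P} II M _.

Section IntervalRep.
Variables (k : fieldType) (d : Order.disp_t) (P : porderType d).

Definition kb (b : bool) : lmodType k :=
  if b then (k^o : lmodType k) else ('rV[k]_0 : lmodType k).

Definition kb_map (b c : bool) : {linear kb b -> kb c} :=
  match b, c return {linear kb b -> kb c} with
  | true, true => (idfun : {linear kb true -> kb true})
  | b, c => (\0 : {linear kb b -> kb c})
  end.

Variable I : pinterval P.

Fact kI_map_id (x : P) (h : (x <= x)%O) (v : kb (x \in (I : set P))) :
  kb_map (x \in (I : set P)) (x \in (I : set P)) v = v.
Proof. by case: (x \in _) v => //= v; apply/rowP => -[]. Qed.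

Fact kI_map_comp (x y z : P) (xy : (x <= y)%O) (yz : (y <= z)%O)
    (xz : (x <= z)%O) (v : kb (x \in (I : set P))) :
  kb_map (x \in (I : set P)) (z \in (I : set P)) v =
  kb_map (y \in (I : set P)) (z \in (I : set P))
    (kb_map (x \in (I : set P)) (y \in (I : set P)) v).
Proof.
have : x \in (I : set P) -> z \in (I : set P) -> y \in (I : set P).
  move=> /set_mem Ix /set_mem Iz; apply/mem_set.
  exact: (pi_convex Ix Iz xy yz).
case: (x \in _) v => v; case: (z \in _); case: (y \in _) => //=.
by move=> /(_ isT isT).
Qed.

Definition kI : rep k P :=
  @Rep k d P (fun x => kb (x \in (I : set P)))
    (fun x y _ => kb_map (x \in (I : set P)) (y \in (I : set P)))
    kI_map_id kI_map_comp.

End IntervalRep.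

Section DirectSumRep.
Variables (k : fieldType) (d : Order.disp_t) (P : porderType d).
Variables (J : Type) (M : J -> rep k P).

Definition dsum_rep_map (x y : P) (xy : (x <= y)%O) :
    {linear dsum (fun j => M j x) -> dsum (fun j => M j y)} :=
  dsum_map (fun j => rep_map (M j) xy).

Fact dsum_rep_map_id (x : P) (h : (x <= x)%O) v : dsum_rep_map h v = v.
Proof. by apply: dsum_inj => j; exact: rep_map_id. Qed.

Fact dsum_rep_map_comp (x y z : P) (xy : (x <= y)%O) (yz : (y <= z)%O)
    (xz : (x <= z)%O) v :
  dsum_rep_map xz v = dsum_rep_map yz (dsum_rep_map xy v).
Proof. by apply: dsum_inj => j; exact: rep_map_comp. Qed.

Definition dsum_rep : rep k P :=
  @Rep k d P (fun x => dsum (fun j => M j x)) dsum_rep_map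
    dsum_rep_map_id dsum_rep_map_comp.

End DirectSumRep.

(* A multi-set of elements of [T] is given as a family [R : J -> T] over an
   arbitrary index type; two families are the same multi-set when every element
   has the same multiplicity (as a cardinal) in both. *)
Definition same_multiset (T J J' : Type) (R : J -> T) (R' : J' -> T) : Prop :=
  forall t : T, R @^-1` [set t] #= R' @^-1` [set t].

Definition k_multiset (k : fieldType) (d : Order.disp_t) (P : porderType d)
    (J : Type) (R : J -> pinterval P) : rep k P :=
  dsum_rep (fun j => kI k (R j)).

(* Main.v *)
(* For every interval I, Rk_I k_R is the number of j with I contained in R_j:
   the composite lim -> colim of the j-th summand is an isomorphism k -> k if I
   is contained in R_j, and otherwise it factors through the value 0 at a point
   of I outside R_j.

   If T is the union of a directed family X in II, the finite sets
   {j | I <= R_j}, I in X, form a downward directed family with intersection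
   {j | T <= R_j}, so one of them equals this intersection, and can be chosen
   to work for R' too.  Hence #{j | T <= R_j} = #{j | T <= R'_j} =: N(T) is
   finite for every T in hat II.  The multiplicity of T is N(T) minus the
   multiplicities of the S strictly containing T, and if T occurs at all then
   N(S) < N(T) for such S, so multiplicities agree by induction on N(T). *)
Require Import Defs.
From HB Require Import structures.
From mathcomp Require Import all_boot all_order all_algebra finmap.
From mathcomp Require Import boolp classical_sets functions cardinality fsbigop.

Set Implicit Arguments.
Unset Strict Implicit.
Unset Printing Implicit Defensive.

Import Order.TTheory GRing.Theory.
Local Open Scope classical_set_scope.
Local Open Scope card_scope.
Local Open Scope ring_scope.

(** * Cardinalities of fibres and of differences of finite sets *)

Lemma card_eq_preimage (T J J' : Type) (R : J -> T) (R' : J' -> T) (D : set T) :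
  (forall t, D t -> R @^-1` [set t] #= R' @^-1` [set t]) ->
  R @^-1` D #= R' @^-1` D.
Proof.
(* A point of [J'] serves as default value outside [D], so the empty [J'] is treated apart. *)
elim/Ppointed: J' => J' in R' *.
  move=> RR'; suff -> : R @^-1` D = set0 by rewrite [R' @^-1` _]emptyE card_eq00.
  rewrite -subset0 => j /RR'; rewrite (_ : R' @^-1` _ = set0); last first.
    by rewrite !emptyE.
  by rewrite card_eq0 => /eqP/seteqP[] /(_ j erefl).
move=> RR'.
(* One bijection is chosen per fibre; as [f t] stays over [t], the glued map sending [j] to
   [f (R j) j] remembers [R j], hence is injective. *)
have /choice[f fP] t : exists f : J -> J', D t ->
    set_bij (R @^-1` [set t]) (R' @^-1` [set t]) f.
  have [/RR'/card_set_bijP[f]|nD] := pselect (D t); first by exists f.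
  by exists (fun=> point) => /nD.
have fR j : D (R j) -> R' (f (R j) j) = R j.
  by move=> /fP[+ _ _] => /(_ j erefl).
apply/card_set_bijP; exists (fun j => f (R j) j); split.
- by move=> j Dj; rewrite /preimage /= fR.
- move=> i j /set_mem Di /set_mem Dj fij.
  have Rij : R i = R j by rewrite -(fR i)// -(fR j)// fij.
  have [_ inj _] := fP _ Di; apply: inj; [exact/mem_set|exact/mem_set/esym|].
  by rewrite fij Rij.
- move=> j' Dj'; have [_ _ /(_ j' erefl)[j /= Rj <-]] := fP _ Dj'.
  by exists j; rewrite /preimage /= Rj.
Qed.

(** Since [A] and [A'] are finite, cardinals are natural numbers and can be subtracted. *)
Lemma card_eq_setD (T T' : Type) (A B : set T) (A' B' : set T') n :
  A #= `I_n -> A' #= `I_n -> B `<=` A -> B' `<=` A' -> B #= B' ->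
  A `\` B #= A' `\` B'.
Proof.
elim/Pchoice: T => T in A B *; elim/Pchoice: T' => T' in A' B' *.
move=> An A'n BA B'A'.
have fA : finite_set A by exists n.
have fA' : finite_set A' by exists n.
have fB := sub_finite_set BA fA; have fB' := sub_finite_set B'A' fA'.
move=> /(fcard_eq fB fB') BB'; apply/(fcard_eq (finite_setD _ fA) (finite_setD _ fA')).
rewrite !fset_setD// !cardfsD !(fsetIidPr _) ?fset_set_sub//; last 2 first.
- by rewrite -fset_set_sub.
- by rewrite -fset_set_sub.
by rewrite BB' (card_fset_set An) (card_fset_set A'n).
Qed.

Lemma sub_card_eq_II_eq (T : Type) (A B : set T) m n :
  A `<=` B -> A #= `I_m -> B #= `I_n -> (n <= m)%N -> A = B.
Proof.
elim/Pchoice: T => T in A B *.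
move=> AB Am Bn nm.
have fA : finite_set A by exists m.
have fB : finite_set B by exists n.
rewrite -(fset_setK fA) -(fset_setK fB); suff /eqP -> : fset_set A == fset_set B by [].
by rewrite eqEfcard (card_fset_set Am) (card_fset_set Bn) nm andbT -fset_set_sub.
Qed.

(** * Multi-sets determined by the number of members containing each interval *)

Section Multisets.
Variables (d : Order.disp_t) (P : porderType d) (II : set (pinterval P)).

Definition above (J : Type) (R : J -> pinterval P) (I : pinterval P) : set J :=
  [set j | pi_set I `<=` R j].

Lemma above_sub (J : Type) (R : J -> pinterval P) (I I' : pinterval P) :
  pi_set I `<=` I' -> above R I' `<=` above R I.
Proof. by move=> II' j I'R; exact: subset_trans I'R. Qed.

Section Counting.
Variables (J J' : Type) (R : J -> pinterval P) (R' : J' -> pinterval P).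
Hypothesis RR' : forall I, II I ->
  exists n, above R I #= `I_n /\ above R' I #= `I_n.

Lemma above_hat (T : pinterval P) : hat II T ->
  exists n, above R T #= `I_n /\ above R' T #= `I_n.
Proof.
move=> [X [XII [[I0 XI0] Xdir] TX]].
(* A single [I] in [X] has to realise the least count for both families at once. *)
pose p n := `[< exists I, [/\ X I, above R I #= `I_n & above R' I #= `I_n] >].
have [n0 [RI0 R'I0]] := RR' (XII _ XI0).
have [|n /asboolP[I [XI In I'n]] nmin] := @ex_minnP p.
  by exists n0; apply/asboolP; exists I0.
have IT : pi_set I `<=` T by rewrite TX => x Ix; exists I.
exists n.
(* [R1] stands for [R] or [R']; the last hypothesis selects the matching half of the common
   count. *)
have aboveE (J1 : Type) (R1 : J1 -> pinterval P) : above R1 I #= `I_n ->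
    (forall I1 m, X I1 -> above R I1 #= `I_m -> above R' I1 #= `I_m ->
       above R1 I1 #= `I_m) ->
    above R1 I = above R1 T.
  move=> I1n R1P; apply/seteqP; split; last exact: above_sub.
  move=> j jI; rewrite /above /= TX => x [I1 XI1 I1x].
  (* Minimality of [n] forces [above R1 I3 = above R1 I], so [R1 j] contains [I3] and thus [I1]. *)
  have [I3 [XI3 I13]] := Xdir _ _ XI XI1.
  have [m [I3m I3'm]] := RR' (XII _ XI3).
  have nm : (n <= m)%N by apply: nmin; apply/asboolP; exists I3.
  have sub13 : pi_set I `<=` I3 by move=> y Iy; apply: I13; left.
  have I1m := R1P _ _ XI3 I3m I3'm.
  rewrite -(sub_card_eq_II_eq (above_sub sub13) I1m I1n nm) in jI.
  by apply: jI; apply: I13; right.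
by rewrite -(aboveE _ R)// -(aboveE _ R').
Qed.

Hypothesis hR : forall j, hat II (R j).
Hypothesis hR' : forall j, hat II (R' j).

Lemma same_multiset_above : same_multiset R R'.
Proof.
have key n : forall T, hat II T -> above R T #= `I_n -> above R' T #= `I_n ->
    R @^-1` [set T] #= R' @^-1` [set T].
  elim/ltn_ind: n => n IHn T hT RT R'T.
  pose D := [set S | [/\ hat II S, pi_set T `<=` S & S <> T]].
  have fiberE (J1 : Type) (R1 : J1 -> pinterval P) : (forall j, hat II (R1 j)) ->
      R1 @^-1` [set T] = above R1 T `\` R1 @^-1` D.
    move=> hR1; apply/seteqP; split=> [j /= jT|j /= [jT nD]].
      by rewrite /above /= jT; split=> // -[].
    by apply: contrapT => nT; apply: nD.
  have [E|N0] := pselect (R @^-1` [set T] = set0 /\ R' @^-1` [set T] = set0).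
    by rewrite E.1 E.2 card_eq00.
  rewrite (fiberE _ R)// (fiberE _ R')//; apply: (card_eq_setD RT R'T).
  - by move=> j [].
  - by move=> j [].
  - apply: card_eq_preimage => S [hS TS nST]; have [m [RS R'S]] := above_hat hS.
    (* If [n <= m], then [above R1 S = above R1 T] for both families, so a member equal to [T] would
       contain [S]; hence [T] occurs in neither, contrary to [N0]. *)
    apply: (IHn m) => //; rewrite ltnNge; apply/negP => nm; apply: N0.
    have ST (J1 : Type) (R1 : J1 -> pinterval P) : above R1 S #= `I_m ->
        above R1 T #= `I_n -> R1 @^-1` [set T] = set0.
      move=> R1S R1T; rewrite -subset0 => j jT.
      have := sub_card_eq_II_eq (above_sub TS) R1S R1T nm.
      move=> /seteqP[_ /(_ j)]; rewrite /above /= jT => /(_ (@subset_refl _ _)) ST.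
      by apply: nST; apply: pinterval_eq; apply/seteqP.
    by split; [exact: ST RS RT|exact: ST R'S R'T].
(* [key] needs [hat II T], known once [T] occurs in some family; otherwise both fibres are empty. *)
move=> T; have [[j <-]|nR] := pselect (exists j, R j = T).
  by have [n []] := above_hat (hR j); apply: key.
have [[j <-]|nR'] := pselect (exists j, R' j = T).
  by have [n []] := above_hat (hR' j); apply: key.
have -> : R @^-1` [set T] = set0 by rewrite -subset0 => j jT; apply: nR; exists j.
have -> : R' @^-1` [set T] = set0 by rewrite -subset0 => j jT; apply: nR'; exists j.
exact: card_eq00.
Qed.

End Counting.
End Multisets.

(** * Rank computed from biorthogonal vectors and functionals *)

Lemma lin_rank_Some (k : fieldType) (V W : lmodType k) (f : {linear V -> W}) n :
  lin_rank f = Some n -> has_dim (range f) n.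
Proof.
by rewrite /lin_rank; case: pselect => // h [<-]; exact: (projT2 (cid h)).
Qed.

(** The identity matrix of size [m] factors through dimension [n]: coordinates of [b] in a basis of
    [U], times values of [phi] on that basis. *)
Lemma has_dim_biorthogonal (k : fieldType) (V : lmodType k) (U : set V) n m
    (b : 'I_m -> V) (phi : 'I_m -> {scalar V}) :
  has_dim U n -> (forall i, U (b i)) ->
  (forall i j, phi i (b j) = (i == j)%:R) -> (m <= n)%N.
Proof.
move=> [e [_ _ eU]] bU phib.
have /choice[C bC] i := eU _ (bU i).
pose M1 := \matrix_(i, l) C i l; pose M2 := \matrix_(l, j) phi j (e l).
have /(congr1 mxrank) : M1 *m M2 = 1%:M.
  apply/matrixP => i j; rewrite !mxE eq_sym -phib bC linear_sum.
  by apply: eq_bigr => l _; rewrite !mxE linearZ.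
by rewrite mxrank1 => <-; apply: leq_trans (mxrankM_maxl _ _) (rank_leq_col _).
Qed.

(** The functionals make the [f (e j)] with [j] in [A] independent, and they span the range.
    Finiteness of [A] comes first: an infinite [A] would contain more than [n] such indices. *)
Lemma lin_rank_biorthogonal (k : fieldType) (V W : lmodType k)
    (f : {linear V -> W}) (J : choiceType) (A : set J) (e : J -> V)
    (phi : J -> {scalar W}) n :
  (forall i j, A i -> A j -> phi i (f (e j)) = (i == j)%:R) ->
  (forall v, exists (s : seq J) (c : J -> k),
    f v = \sum_(j <- s | j \in A) c j *: f (e j)) ->
  lin_rank f = Some n -> A #= `I_n.
Proof.
move=> phif spanf /lin_rank_Some fn.
pose g (s : seq J) : 'I_(size s) -> J := tnth (in_tuple s).
have gA (s : seq J) : {subset s <= A} -> forall i, A (g s i).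
  by move=> sA i; apply/set_mem/sA; exact: mem_tnth.
have phig (s : seq J) : uniq s -> {subset s <= A} ->
    forall i j, phi (g s i) (f (e (g s j))) = (i == j)%:R.
  move=> us sA i j; rewrite phif; [|exact: gA|exact: gA].
  by congr (nat_of_bool _)%:R; apply: inj_eq; exact/tuple_uniqP.
have [[X AX]|infA] := pselect (exists X : {fset J}, A = [set` X]); last first.
  have [|X XA nX] := @infinite_set_fset _ A n.+1; first exact/finite_fsetP.
  have XsA : {subset enum_fset X <= A} by move=> j jX; exact/mem_set/XA.
  have := has_dim_biorthogonal fn (fun i => imageT f (e (g (enum_fset X) i))).
  move=> /(_ _ (phig _ (fset_uniq X) XsA)).
  by rewrite leqNgt nX.
have XsA : {subset enum_fset X <= A} by move=> j jX; rewrite AX; exact/mem_set.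
rewrite AX; apply/card_eq_fsetP; apply: has_dim_uniq fn.
pose b i := f (e (g (enum_fset X) i)); exists b; split.
- by move=> i; exists (e (g (enum_fset X) i)).
- move=> c /(congr1 (phi (g (enum_fset X) _))) c0 i; have := c0 i.
  rewrite linear0 linear_sum (bigD1 i)//= linearZ /= phig// eqxx mulr1.
  rewrite big1 ?addr0// => j ji; rewrite linearZ /= phig//.
  by rewrite eq_sym (negbTE ji) mulr0.
move=> _ [v _ <-]; have [s [c ->]] := spanf v.
(* [s] may have repetitions and entries outside [A], so the sum is put into the span of [b] term by
   term. *)
pose Q (w : W) := exists c : 'I_(size (enum_fset X)) -> k, w = \sum_i c i *: b i.
apply: (big_ind Q) => [|_ _ [c1 ->] [c2 ->]|j jA].
- by exists (fun=> 0); rewrite big1// => i _; rewrite scale0r.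
- exists (fun i => c1 i + c2 i); rewrite -big_split.
  by apply: eq_bigr => i _; rewrite scalerDl.
have /tnthP[i ij] : j \in in_tuple (enum_fset X).
  by move: jA; rewrite AX => /set_mem.
exists (fun i' => if i' == i then c j else 0); rewrite (bigD1 i)//= eqxx.
rewrite big1 ?addr0; first by rewrite /b /g -ij.
by move=> i' /negbTE ->; rewrite scale0r.
Qed.

(** * Linear maps out of direct sums and quotients *)

Lemma dsum_map_in (k : fieldType) (T : eqType) (V W : T -> lmodType k)
    (F : forall t, {linear V t -> W t}) t (v : V t) :
  dsum_map F (dsum_in v) = dsum_in (F t v).
Proof.
apply: dsum_inj => s; rewrite /dsum_map /dsum_in /= /dprod_fun /=.
case: (eqVneq t s) => [ts|ts]; last by rewrite !dfwith_out // linear0.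
by case: s / ts; rewrite !dfwith_in.
Qed.

Lemma dsum_in_eq (k : fieldType) (T : eqType) (V : T -> lmodType k) t (v : V t) :
  dsum_in v t = v.
Proof. by rewrite /= /dprod_fun dfwith_in. Qed.

Lemma dsum_in_neq (k : fieldType) (T : eqType) (V : T -> lmodType k) t s (v : V t) :
  t != s -> dsum_in v s = 0.
Proof. by move=> ts; rewrite /= /dprod_fun dfwith_out. Qed.

Lemma dsum_sum_in (k : fieldType) (T : choiceType) (V : T -> lmodType k)
    (u : dsum V) (X : {fset T}) :
  [set t | u t != 0] `<=` [set` X] -> u = \sum_(t <- X) dsum_in (u t).
Proof.
move=> uX; apply: dsum_inj => s.
have -> : (\sum_(t <- X) dsum_in (u t)) s = \sum_(t <- X) (dsum_in (u t) s).
  exact: (big_morph (fun w : dsum V => w s)).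
have [sX|sX] := boolP (s \in X).
  rewrite (big_fsetD1 s)//= [X in _ = X + _]dsum_in_eq big_seq big1 ?addr0// => t.
  by rewrite !inE => /andP[ts _]; rewrite dsum_in_neq.
rewrite big_seq big1.
  by apply/eqP; apply: contraNT sX => /uX.
by move=> t tX; rewrite dsum_in_neq//; apply: contraNneq sX => <-.
Qed.

(** Universal property of the quotient: the kernel of [g] is a subspace containing [S], hence
    contains its span. *)
Lemma quot_lift (k : fieldType) (V U : lmodType k) (S : set V)
    (g : {linear V -> U}) : (forall v, S v -> g v = 0) ->
  exists h : {linear quotsp S -> U}, forall v, h (quot_pi S v) = g v.
Proof.
move=> gS.
have gspan v : v \in lspan S -> g v = 0.
  rewrite unfold_in => /set_mem; apply: (smallest_sub (X := [set v | g v = 0])) => //.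
  split=> [|a u w]; rewrite !inE /= ?linear0// => gu gw.
  by rewrite linearP gu gw scaler0 addr0.
pose h (x : quotsp S) : U := g (sval (cid (quot_surj x))).
have hE v : h (quot_pi S v) = g v.
  rewrite /h; case: cid => u /= /quot_piP/gspan.
  by rewrite linearB => /eqP; rewrite subr_eq0 => /eqP.
have hlin : linear h.
  move=> a x y; have [u ->] := quot_surj x; have [w ->] := quot_surj y.
  by rewrite -linearP !hE linearP.
pose H := GRing.isLinear.Build k _ _ _ h hlin.
by exists (HB.pack h H : {linear _ -> _}).
Qed.

Definition dsum_proj (k : fieldType) (T : Type) (V : T -> lmodType k) t
  (u : dsum V) : V t := u t.

Fact dsum_proj_linear (k : fieldType) (T : Type) (V : T -> lmodType k) t :
  linear (@dsum_proj k T V t).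
Proof. by []. Qed.
HB.instance Definition _ (k : fieldType) (T : Type) (V : T -> lmodType k) t :=
  GRing.isLinear.Build k (dsum V) (V t) *:%R (@dsum_proj k T V t)
    (@dsum_proj_linear k T V t).

Section Coordinates.
Variables (k : fieldType) (T : choiceType) (V : T -> lmodType k).
Variables (U : lmodType k) (G : forall t, {linear V t -> U}).

(** The map that the coproduct property induces from the [G t]. *)
Definition dsum_fold (u : dsum V) : U := \sum_(t \in setT) G t (u t).

Lemma dsum_foldE (u : dsum V) (X : {fset T}) :
  [set t | u t != 0] `<=` [set` X] -> dsum_fold u = \sum_(t <- X) G t (u t).
Proof.
move=> uX; apply: fsbigTE => t tX; have -> : u t = 0; last exact: linear0.
by apply/eqP; apply: contraNT tX => /uX.
Qed.

Fact dsum_fold_linear : linear dsum_fold.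
Proof.
move=> a u v.
have /finite_fsetP[X uX] : finite_set [set t | u t != 0] by have /asboolP := valP u.
have /finite_fsetP[Y vY] : finite_set [set t | v t != 0] by have /asboolP := valP v.
(* The union of [X] and [Y] is a common support for [u], [v] and their combination. *)
have sub (w : dsum V) : (forall t, u t = 0 -> v t = 0 -> w t = 0) ->
    [set t | w t != 0] `<=` [set` (X `|` Y)%fset].
  move=> w0 t /=; apply: contraNT; rewrite inE negb_or => /andP[tX tY].
  apply/eqP/w0; apply/eqP.
    by apply: contraNT tX => ut; have : [set` X] t by rewrite -uX.
  by apply: contraNT tY => vt; have : [set` Y] t by rewrite -vY.
rewrite !(dsum_foldE (sub _ _))//; last first.
  by move=> t /= u0 v0; change (a *: u t + v t = 0); rewrite u0 v0 scaler0 addr0.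
rewrite scaler_sumr -big_split; apply: eq_bigr => t _ /=.
exact: (linearP (G t) a (u t) (v t)).
Qed.
HB.instance Definition _ :=
  GRing.isLinear.Build k (dsum V) U *:%R dsum_fold dsum_fold_linear.

Lemma dsum_fold_in t (v : V t) : dsum_fold (dsum_in v) = G t v.
Proof.
rewrite (@dsum_foldE _ [fset t]%fset).
  by rewrite big_seq_fset1 dsum_in_eq.
move=> s /=; rewrite inE; apply: contraNT => st.
by rewrite dsum_in_neq// eq_sym.
Qed.

End Coordinates.

(** * Rank of a direct sum of interval representations *)

Section RankOfMultiset.
Variables (k : fieldType) (d : Order.disp_t) (P : porderType d).
Variables (J : choiceType) (R : J -> pinterval P) (I : pinterval P).

Local Notation M := (restr I (k_multiset k R)).

(** The two sides could differ only if a zero space sat between two copies of the field, which the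
    hypothesis excludes. *)
Lemma kb_mapC (a b c : bool) : (a -> c -> b) ->
  forall v : kb k a, kb_map k a c v = kb_map k b c (kb_map k a b v).
Proof. by case: a; case: c; case: b => //= /(_ isT isT). Qed.

Lemma kb_expand (b : bool) (v : kb k b) :
  v = (kb_map k b true v : k^o) *: kb_map k true b (1 : k^o).
Proof. 
case: b v => v /=; first by rewrite [_ *: _]mulr1.
by apply/rowP => -[].
Qed.

Lemma canonical_map_at (f : limit M) (x : subposet I) :
  canonical_map (k_multiset k R) I f = colimit_in M x (f x).
Proof. exact: canonical_mapE. Qed.

(** The final [kb_map] gives all coordinates one fixed target, with value 0 at points outside
    [R j]. *)
Definition kcoord (x : subposet I) (j : J) : {linear M x -> kb k true} :=
  kb_map k (val x \in pi_set (R j)) true \o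
    @dsum_proj k J (fun j => kI k (R j) (val x)) j.

Definition kin (x : subposet I) (j : J) : {linear kI k (R j) (val x) -> M x} :=
  (@dsum_in k J (fun j => kI k (R j) (val x)) j : {linear _ -> _}).

Definition kunit (x : subposet I) (j : J) : M x :=
  kin x j (kb_map k true (val x \in pi_set (R j)) (1 : k^o)).

Lemma rep_map_kin (x y : subposet I) (xy : (x <= y)%O) j v :
  rep_map M xy (kin x j v) = kin y j (rep_map (restr I (kI k (R j))) xy v).
Proof. exact: dsum_map_in. Qed.

(** Keeping the premise under the existential lets [choice] produce a family over all of [J], with 0
    as default. *)
Lemma exists_section j : exists e : limit M, above R I j ->
  forall x, e x = kunit x j.
Proof.
have [jI|nj] := pselect (above R I j); last by exists 0.
have ec : ((fun x => kunit x j) : dprod M) \in @compatible _ _ _ M.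
  apply/asboolP => x y xy; rewrite /= rep_map_kin; congr (kin _ _ _).
  apply/esym/kb_mapC => _ _.
  by apply/mem_set/jI/set_mem/(valP x).
by exists (Limit ec).
Qed.

Lemma exists_coord j : exists phi : {scalar colimit M}, above R I j ->
  forall x (u : M x), phi (colimit_in M x u) = kcoord x j u.
Proof.
have [jI|nj] := pselect (above R I j); last by exists \0.
(* The coordinates define a functional on the direct sum; it kills the relations because all of [I]
   lies in [R j]. *)
have [|h hE] := @quot_lift k _ _ (@colimit_rel _ _ _ M)
    (dsum_fold (fun x => kcoord x j)).
  move=> _ [x [y [xy [v ->]]]]; rewrite linearB /= !dsum_fold_in.
  apply/eqP; rewrite subr_eq0; apply/eqP.
  apply: (@kb_mapC (val x \in pi_set (R j)) (val y \in pi_set (R j)) true _ (v j)).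
  by move=> _ _; exact/mem_set/jI/set_mem/(valP y).
exists h => _ x u; exact: etrans (hE _) (dsum_fold_in _ _).
Qed.

Fact summand_compatible j (f : limit M) :
  ((fun x => kin x j (dsum_proj j (f x))) : dprod M) \in @compatible _ _ _ M.
Proof.
apply/asboolP => x y xy; have /asboolP fc := valP f.
rewrite /= rep_map_kin.
exact: (congr1 (fun u : M y => kin y j (dsum_proj j u)) (fc x y xy)).
Qed.
Definition summand j (f : limit M) : limit M := Limit (summand_compatible j f).

(** The canonical map may be computed at a point of [I] outside [R j], where the section
    vanishes. *)
Lemma canonical_summand0 j f : ~ above R I j ->
  canonical_map (k_multiset k R) I (summand j f) = 0.
Proof.
move=> /existsNP[y /not_implyP[Iy nRy]].
pose y' : subposet I := exist _ y (mem_set Iy).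
rewrite (canonical_map_at _ y').
suff -> : summand j f y' = 0 by exact: linear0.
rewrite -[RHS](linear0 (kin y' j)); congr (kin _ _ _).
move: (dsum_proj _ _) => /=; rewrite memNset//= => v.
by apply/rowP => -[].
Qed.

(** A section need not be a finite sum of its summands, since supports vary with the point; its
    image in the colimit depends only on the value at [x], whose support is finite. *)
Lemma canonical_map_sum (f : limit M) (x : subposet I) (X : {fset J}) :
  [set j | dsum_proj j (f x) != 0] `<=` [set` X] ->
  canonical_map (k_multiset k R) I f =
  \sum_(j <- X) canonical_map (k_multiset k R) I (summand j f).
Proof.
move=> fX; rewrite (canonical_map_at f x).
rewrite [X in colimit_in _ _ X](dsum_sum_in fX) linear_sum.
by apply: eq_bigr => j _; rewrite (canonical_map_at _ x).
Qed.

Lemma Rk_k_multiset n : Rk I (k_multiset k R) = Some n -> above R I #= `I_n.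
Proof.
have /choice[e eP] := exists_section.
have /choice[phi phiP] := exists_coord.
pose x := pi_point I.
have oneE j : above R I j ->
  kb_map k (val x \in pi_set (R j)) true
   (kb_map k true (val x \in pi_set (R j)) (1 : k^o)) = (1 : k^o).
  move=> jI; rewrite (mem_set (jI _ (set_mem (valP x)))) //.
apply: (@lin_rank_biorthogonal _ _ _ _ _ _ e phi).
  move=> i j iI jI; rewrite (canonical_map_at _ x) phiP// eP// /kcoord /=.
  case: eqVneq => [->|ij].
    apply: etrans (oneE _ jI); apply: (congr1 (kb_map k _ true)).
    exact: (@dsum_in_eq k J (fun j => kI k (R j) (val x))).
  apply: etrans (linear0 (kb_map k (val x \in pi_set (R i)) true)).
  apply: (congr1 (kb_map k _ true)).
  by apply: (@dsum_in_neq k J (fun j => kI k (R j) (val x))); rewrite eq_sym.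
move=> f.
have /finite_fsetP[X fX] : finite_set [set j | dsum_proj j (f x) != 0].
  by have /asboolP := valP (f x).
(* Terms with [j] outside [above R I] vanish in the colimit; the others are coordinates at [x] times
   the unit section. *)
exists X, (fun j => kcoord x j (f x)).
rewrite (@canonical_map_sum f x X); last by rewrite fX.
rewrite [RHS]big_mkcond; apply: eq_bigr => j _.
case: ifPn => [/set_mem jI|/negP jI]; last first.
  by rewrite canonical_summand0// => /mem_set.
rewrite !(canonical_map_at _ x) -linearZ; congr (colimit_in _ _ _).
rewrite eP// -linearZ; congr (kin _ _ _); exact: kb_expand.
Qed.

End RankOfMultiset.

Theorem proposition2p4 (k : fieldType) (d : Order.disp_t) (P : porderType d)
    (II : set (pinterval P)) (J J' : Type)
    (R : J -> pinterval P) (R' : J' -> pinterval P) :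
  (forall j, hat II (R j)) ->
  (forall j, hat II (R' j)) ->
  rank_inv II (k_multiset k R) = rank_inv II (k_multiset k R') ->
  (forall I, rank_inv II (k_multiset k R) I <> None) ->
  same_multiset R R'.
Proof.
move=> hR hR' RR' Rfin; apply: same_multiset_above hR hR' => I III.
pose I' : II := exist _ I (mem_set III).
have := congr1 (@^~ I') RR'; have := Rfin I'; rewrite /rank_inv /=.
case E : (Rk _ _) => [n|] // _ /esym E'; exists n; split.
  (* [{classic J}] equips the arbitrary index type with a choice structure. *)
  exact: (@Rk_k_multiset k d P {classic J} R I n).
exact: (@Rk_k_multiset k d P {classic J'} R' I n).
Qed.
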